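(* Let $X,Y\subseteq\mathsf{all}$ be such that $X\neq\emptyset$ and for all $x\in X$ there is $y\in Y$ with $y\ne x$. If $X\cap[0,1]\ne\emptyset$, then $(2^\omega,\mathcal N,\in)\le_T(D_X,\mathrm{Sym}(\omega),R_Y)$.
   Context: Relational systems: a relational system is a triple $\mathcal A=(A_-,A_+,A)$ with $A\subseteq A_-\times A_+$ such that for every $a_-\in A_-$ there is $a_+\in A_+$ with $a_-\,A\,a_+$, and for every $a_+\in A_+$ there is $a_-\in A_-$ for which $a_-\,A\,a_+$ fails. $\mathcal A\le_T\mathcal B$ (Tukey reducibility), for $\mathcal B=(B_-,B_+,B)$, means that there are functions $\varphi_-:A_-\to B_-$ and $\varphi_+:B_+\to A_+$ such that for all $a_-\in A_-$, $b_+\in B_+$: $\varphi_-(a_-)\,B\,b_+$ implies $a_-\,A\,\varphi_+(b_+)$. Density: $n\in\omega$ is identified with $\{0,\dots,n-1\}$. For $A\subseteq\omega$, $\underline d(A)=\liminf_n|A\cap n|/n$ and $\overline d(A)=\limsup_n|A\cap n|/n$; if they are equal, $d(A)$ denotes the common value; if $\underline d(A)<\overline d(A)$, write $d(A)=\mathsf{osc}$, where $\mathsf{osc}$ is a formal symbol. $\mathsf{all}=[0,1]\cup\{\mathsf{osc}\}$. $\mathrm{Sym}(\omega)$ is the set of permutations of $\omega$. $D_X$ is the collection of infinite-coinfinite sets $A\subseteq\omega$ with $d(A)\in X$. For $A\in D_X$ and $\pi\in\mathrm{Sym}(\omega)$, $A\,R_Y\,\pi$ means $d(\pi[A])\in Y$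 and $d(\pi[A])\ne d(A)$. $\mathcal N$ is the ideal of null subsets of the Cantor space $2^\omega$ (with respect to the standard product measure); in $(2^\omega,\mathcal N,\in)$, $x$ is related to $N$ iff $x\in N$. *)

(* Defs.v *)
From HB Require Import structures.
From mathcomp Require Import all_boot all_order all_algebra.
From mathcomp Require Import all_classical all_reals all_analysis.

Set Implicit Arguments.
Unset Strict Implicit.
Unset Printing Implicit Defensive.

Import Order.TTheory GRing.Theory Num.Theory.
Import numFieldNormedType.Exports.

Local Open Scope classical_set_scope.
Local Open Scope ring_scope.

                                                  

Record triple := Triple {
  minus_part : Type;
  plus_part : Type;
  related : minus_part -> plus_part -> Prop }.

Definition is_relational_system (A : triple) : Prop :=
  (forall a : minus_part A, exists b : plus_part A, related a b) /\
  (forall b : plus_part A, exists a : minus_part A, ~ related a b).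

                                                                           
                                                               
Definition tukey_le (A B : triple) : Prop :=
  [/\ is_relational_system A, is_relational_system B &
    exists (f : minus_part A -> minus_part B) (g : plus_part B -> plus_part A),
      forall (a : minus_part A) (b : plus_part B),
        related (f a) b -> related a (g b)].

                           

Section density.
Context {R : realType}.

Definition initial_card (A : set nat) (n : nat) : nat :=
  #|[pred i : 'I_n | (i : nat) \in A]|.

                                                                    
Definition density_seq (A : set nat) : R^nat :=
  fun n => (initial_card A n)%:R / n%:R.

Definition lower_density (A : set nat) : R := limn_inf (density_seq A).
Definition upper_density (A : set nat) : R := limn_sup (density_seq A).

Inductive density_value : Type := Dens of R | Osc.

Definition density (A : set nat) : density_value :=
  if lower_density A == upper_density A then Dens (lower_density A) else Osc.

Definition unit_values : set density_value :=
  [set Dens r | r in [set r : R | 0 <= r <= 1]].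

Definition all_values : set density_value := unit_values `|` [set Osc].

Definition D_ (X : set density_value) : set (set nat) :=
  [set A | [/\ infinite_set A, infinite_set (~` A) & X (density A)]].

Definition Sym_nat : set (nat -> nat) := [set p | bijective p].

Definition R_ (Y : set density_value) (A : set nat) (p : nat -> nat) : Prop :=
  Y (density (p @` A)) /\ density (p @` A) <> density A.

Definition density_triple (X Y : set density_value) : triple :=
  @Triple (D_ X) Sym_nat (fun A p => R_ Y (\val A) (\val p)).

End density.

Arguments density_value : clear implicits.

                                                

Section clopen_algebra.

Definition determined (n : nat) (A : set cantor_space) : Prop :=
  forall x y : cantor_space, (forall i, (i < n)%N -> x i = y i) -> A x -> A y.

Definition clopen_cantor : Type := cantor_space.
HB.instance Definition _ := Pointed.on clopen_cantor.

                                                                              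
                                                                        
Definition clopen_sets : set (set clopen_cantor) :=
  [set A | exists n, determined n A].

Lemma determined_le m n A : (m <= n)%N -> determined m A -> determined n A.
Proof.
move=> mn dA x y xy; apply: dA => i im; apply: xy; exact: leq_trans im mn.
Qed.

Lemma determinedC n A : determined n A -> determined n (~` A).
Proof. by move=> dA x y xy nAx /dA Ay; apply/nAx/Ay => i /xy. Qed.

Lemma determinedU n A B :
  determined n A -> determined n B -> determined n (A `|` B).
Proof.
by move=> dA dB x y xy [/(dA _ _ xy)|/(dB _ _ xy)] ?; [left|right].
Qed.

Fact clopen0 : clopen_sets set0. Proof. by exists 0%N. Qed.

Fact clopenU : setU_closed clopen_sets.
Proof.
move=> A B [m dA] [n dB]; exists (maxn m n).
by apply: determinedU; [apply: determined_le dA|apply: determined_le dB];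
  rewrite ?leq_maxl ?leq_maxr.
Qed.

Fact clopenC : setC_closed clopen_sets.
Proof. by move=> A [n dA]; exists n; exact: determinedC. Qed.

Fact clopen_display : measure_display. Proof. exact. Qed.

HB.instance Definition _ := isAlgebraOfSets.Build clopen_display clopen_cantor
  clopen0 clopenU clopenC.

Lemma determined_open n A : determined n A -> open A.
Proof.
move=> dA; rewrite openE => x Ax.
have : \forall y \near x, forall i : 'I_n, (y : cantor_space) i = x i.
  apply: (@filter_forall _ _ _ (nbhs x)) => i.
  have /(_ [set x (i : nat)]) := @proj_continuous nat (fun=> bool) i x.
  by apply; exact: discrete_set1.
by apply: filterS => y xy; apply: dA Ax => i ni; rewrite (xy (Ordinal ni)).
Qed.

Lemma clopen_finite_cover (A : set cantor_space) (F : nat -> set cantor_space) :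
  clopen_sets A -> (forall k, clopen_sets (F k)) -> A `<=` \bigcup_k F k ->
  exists N, forall x, A x -> exists2 k, (k < N)%N & F k x.
Proof.
move=> [n dA] cF AF.
have cA : compact A.
  apply: (subclosed_compact _ cantor_space_compact) => //.
  by rewrite -[A]setCK; apply: open_closedC; apply: determined_open;
    exact: determinedC dA.
move: cA; rewrite compact_cover => /(_ nat setT F) [k _|//|D _ AD].
  by have [m dF] := cF k; exact: determined_open dF.
exists (\max_(k <- finmap.enum_fset D) k).+1 => x /AD [k /= kD Fx]; exists k => //.
by rewrite ltnS; exact: leq_bigmax_seq.
Qed.

End clopen_algebra.

Section product_measure.
Context (R : realType).

Definition seq_cons (b : bool) (x : cantor_space) : cantor_space :=
  fun n => if n is m.+1 then x m else b.

                                                                            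
                                                                    
Fixpoint coin_prob (n : nat) (A : set cantor_space) : R :=
  if n is m.+1 then
    (coin_prob m (seq_cons false @^-1` A) +
     coin_prob m (seq_cons true @^-1` A)) / 2
  else (point \in A)%:R.

Lemma coin_prob_ge0 n A : 0 <= coin_prob n A.
Proof. by elim: n A => [|n IH] A //=; rewrite divr_ge0 // addr_ge0. Qed.

Lemma coin_prob0 n : coin_prob n set0 = 0.
Proof.
elim: n => [|n IH] /=; first by rewrite in_set0.
by rewrite !preimage_set0 IH addr0 mul0r.
Qed.

Lemma coin_probU n A B : A `&` B = set0 ->
  coin_prob n (A `|` B) = coin_prob n A + coin_prob n B.
Proof.
elim: n A B => [|n IH] A B AB /=.
  rewrite in_setU; have : (point \in A `&` B) = false by rewrite AB in_set0.
  by rewrite in_setI; case: (_ \in A); case: (_ \in B) => //= _;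
    rewrite ?addr0 ?add0r.
have AB0 b : seq_cons b @^-1` A `&` seq_cons b @^-1` B = set0.
  by rewrite -preimage_setI AB preimage_set0.
by rewrite 2!preimage_setU (IH _ _ (AB0 false)) (IH _ _ (AB0 true)) -mulrDl
  addrACA.
Qed.

Lemma determined_cons n b A : determined n.+1 A ->
  determined n (seq_cons b @^-1` A).
Proof. by move=> dA x y xy; apply: dA => -[//|i] /= /xy. Qed.

Lemma coin_prob_determined m n A : (m <= n)%N -> determined m A ->
  coin_prob n A = coin_prob m A.
Proof.
elim: m n A => [|m IH] [|n] A // mn dA; last first.
  by rewrite /= !(IH n) //; exact: determined_cons.
elim: n.+1 A {mn} dA => [|k IH] A dA //=.
have -> : seq_cons false @^-1` A = A.
  by apply/seteqP; split => x /=; exact: dA.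
have -> : seq_cons true @^-1` A = A.
  by apply/seteqP; split => x /=; exact: dA.
by rewrite (IH A dA) -mulr2n -[_ *+ 2]mulr_natr mulfK // pnatr_eq0.
Qed.

Definition clopen_measure (A : set clopen_cantor) : \bar R :=
  (coin_prob (xget 0%N [set n | determined n A]) A)%:E.

Lemma clopen_measureE n A : determined n A ->
  clopen_measure A = (coin_prob n A)%:E.
Proof.
move=> dA; rewrite /clopen_measure.
case: xgetP => [m _ /= dm|/(_ n)//].
have [mn|/ltnW nm] := leqP m n.
  by rewrite (coin_prob_determined mn).
by rewrite (coin_prob_determined nm).
Qed.

Fact clopen_measure0 : clopen_measure set0 = 0%E.
Proof. by rewrite /clopen_measure coin_prob0. Qed.

Fact clopen_measure_ge0 A : (0 <= clopen_measure A)%E.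
Proof. by rewrite lee_fin coin_prob_ge0. Qed.

Fact clopen_measureU (A B : set clopen_cantor) :
  clopen_sets A -> clopen_sets B -> A `&` B = set0 ->
  clopen_measure (A `|` B) = (clopen_measure A + clopen_measure B)%E.
Proof.
move=> [m dA] [n dB] AB.
have {}dA := determined_le (leq_maxl m n) dA.
have {}dB := determined_le (leq_maxr m n) dB.
rewrite (clopen_measureE dA) (clopen_measureE dB).
by rewrite (clopen_measureE (determinedU dA dB)) coin_probU.
Qed.

Fact clopen_measure_semi_sigma_additive : semi_sigma_additive clopen_measure.
Proof.
move=> F mF tF mUF.
have [N FN] := clopen_finite_cover mUF mF (@subset_refl _ _).
have F0 k : (N <= k)%N -> F k = set0.
  move=> Nk; rewrite -subset0 => x Fkx.
  have [|j jN Fjx] := FN x; first by exists k.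
  have jk : j = k by apply: (tF j k) => //; exists x.
  by rewrite -jk leqNgt jN in Nk.
have FS n : clopen_sets (\big[setU/set0]_(k < n) F k) /\
    clopen_measure (\big[setU/set0]_(k < n) F k) =
      (\sum_(0 <= k < n) clopen_measure (F k))%E.
  elim: n => [|n [IH1 IH2]].
    by rewrite big_ord0 big_geq // clopen_measure0; split; [exact: clopen0|].
  rewrite big_ord_recr big_nat_recr //= -IH2; split.
    by apply: (@measurableU _ clopen_cantor).
  apply: clopen_measureU; [exact: IH1|exact: mF|].
  rewrite -subset0 => x [].
  rewrite -bigcup_mkord => -[j /= jn Fjx] Fnx.
  have jE : j = n by apply: (tF j n) => //; exists x.
  by rewrite jE ltnn in jn.
apply: cvg_near_cst; near=> n.
rewrite -(FS n).2 -bigcup_mkord; suff -> : \bigcup_k F k = \bigcup_(k < n) F k.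
  by [].
apply/seteqP; split => x => [/FN[k kN Fx]|[k _ Fx]]; exists k => //=.
by apply: leq_trans kN _; near: n; exact: nbhs_infty_ge.
Unshelve. all: by end_near. Qed.

HB.instance Definition _ := isMeasure.Build _ _ _ clopen_measure
  clopen_measure0 clopen_measure_ge0 clopen_measure_semi_sigma_additive.

                                                                            
                                                 
Definition product_measure := measure_extension clopen_measure.
HB.instance Definition _ := Measure.on product_measure.

Lemma product_measure_cylinder (n : nat) (s : nat -> bool) :
  product_measure [set x | forall i, (i < n)%N -> x i = s i] =
    (2^-1 ^+ n)%:E.
Proof.
set C := [set x | _].
have dC : determined n C.
  by move=> x y xy Cx i ni; rewrite -xy // Cx.
rewrite /product_measure /measure_extension /= measurable_mu_extE /=; last first.
  by exists n.
rewrite (clopen_measureE dC); congr (_%:E); rewrite {dC}/C.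
elim: n s => [|n IH] s /=.
  by rewrite mem_set // expr0.
have E b : seq_cons b @^-1` [set x | forall i, (i < n.+1)%N -> x i = s i] =
    if b == s 0%N then [set x | forall i, (i < n)%N -> x i = s i.+1] else set0.
  case: eqP => bs; apply/seteqP; split => x //=.
  - by move=> H i ni; have := H i.+1 ni.
  - by move=> H [_|i ni] /=; [|exact: H].
  - by move=> H; apply/bs/(H 0%N).
by rewrite !E exprSr; case: (s 0%N) => /=;
  rewrite coin_prob0 (IH (fun i => s i.+1)) ?add0r ?addr0.
Qed.

Definition null_sets : set (set cantor_space) :=
  [set N | product_measure.-negligible N].

Definition null_triple : triple :=
  @Triple cantor_space null_sets (fun x N => (\val N) x).

End product_measure.

(* Main.v *)
Require Import Defs.
From mathcomp Require Import all_boot all_order all_algebra.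
From mathcomp Require Import all_classical all_reals all_analysis.
From mathcomp Require Import zify lra.

(** Fix r in [0, 1] with Dens r in X. The idea is to attach to every point x of
    the Cantor space a random-looking infinite and coinfinite set F x such that,
    for each single permutation p, the image p @` F x has density r for almost
    every x. The Tukey map then sends x to F x (or to a fixed set of density r
    on the null set where F x itself fails to have density r), and sends p to
    the null set of all x for which F x or p @` F x fails to have density r: off
    that set, p does not change the density, so p cannot answer x.

    The set F x (lemma [random_set]) is made from two ingredients.

    - A Bernoulli set G x ([bernoulli_set]): n belongs to G x when the n-th
      block of bits of x falls in a clopen set of probability p_n, where
      |p_n - r| <= 2^-n and distinct blocks are disjoint. A permutation merely
      reorders independent events, so the strong law of large numbers
      ([strong_lln], from variances, Chebyshev's inequality along fourth powers
      and the first Borel-Cantelli lemma) gives density r to p @` G x almost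
      surely.

    - A sparse set T x, the set of the numbers t_k that encode the first 4k
      bits of x. A given number is t_k with probability at most 2^-4k, so
      p t_k < k^2 has probability at most k^2 2^-4k, and by Borel-Cantelli
      p t_k >= k^2 for all large k: the image p @` T x has density 0 almost
      surely ([sparse_codes]).

    Putting t_k in F x for even k and out of F x for odd k makes F x infinite
    and coinfinite for every x, even when r is 0 or 1, and changes the counting
    function of p @` G x by a sublinear amount only.

    All the events involved are clopen, so the only probabilities needed are the
    finite averages [coin_prob], extended from sets to functions by [mean].

    It remains to see that both triples are relational systems. A point is null
    and the whole space is not. Every value of the density is attained by an
    infinite coinfinite set ([density_surjective]), and permutations act
    transitively on these sets ([permutation_image]), so every A is answered by
    some permutation. Finally no permutation p answers everything, since a point
    outside the null set attached to p is sent to a set that p does not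
    answer. *)

Set Implicit Arguments.
Unset Strict Implicit.
Unset Printing Implicit Defensive.

Import Order.TTheory GRing.Theory Num.Theory.
Import numFieldNormedType.Exports.

Local Open Scope classical_set_scope.

(** * Null sets of the Cantor space *)

Section null_sets.
Local Open Scope ring_scope.
Context (R : realType).

Lemma product_measure_determined n (A : set clopen_cantor) :
  determined n A -> product_measure R A = (coin_prob R n A)%:E.
Proof.
move=> dA; rewrite -(clopen_measureE R dA).
by rewrite /product_measure /measure_extension measurable_mu_extE //; exists n.
Qed.

Lemma determined_measurable n (A : set clopen_cantor) : determined n A ->
  <<s @measurable clopen_display clopen_cantor >> A.
Proof. by move=> dA; apply: sub_sigma_algebra; exists n. Qed.

Lemma sum_inv_squares (n : nat) : \sum_(k < n) (k.+1%:R ^- 2) <= 2 :> R.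
Proof.
(* For n = 0 the bound below is 2, because 0^-1 = 0. *)
suff : \sum_(k < n) (k.+1%:R ^- 2) <= 2 - n%:R^-1 :> R.
  by move=> /le_trans; apply; rewrite lerBlDr lerDl invr_ge0.
elim: n => [|[|n] IH]; first by rewrite big_ord0 invr0; lra.
  by rewrite big_ord1 expr1n invr1; lra.
rewrite big_ord_recr /=; apply: le_trans (lerD IH (lexx _)) _.
have a0 : (0 : R) < n.+1%:R by rewrite ltr0Sn.
rewrite -[n.+2%:R]natr1; move: n.+1%:R a0 => a a0.
have a1 : 0 < a + 1 by lra.
have aa : a^-1 - (a + 1)^-1 = a^-1 * (a + 1)^-1.
  apply: (mulfI (x := a * (a + 1))); first by rewrite mulf_neq0 // gt_eqF.
  rewrite mulrBr mulrAC mulfV ?gt_eqF // mulrACA mulrK ?unitf_gt0 //.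
  by rewrite mulfV ?gt_eqF // mulfV ?gt_eqF //; lra.
suff : (a + 1) ^- 2 <= a^-1 * (a + 1)^-1 by lra.
rewrite expr2 invfM ler_pM2r ?invr_gt0 // lef_pV2 ?posrE //; lra.
Qed.

(** The first Borel-Cantelli lemma, for clopen events and the one summable
    majorant that is needed. *)
Lemma borel_cantelli (M : R) (C : nat -> set clopen_cantor) :
  (forall k, exists2 n, determined n (C k) &
    coin_prob R n (C k) <= M / k.+1%:R ^+ 2) ->
  null_sets R (lim_sup_set C).
Proof.
move=> CP.
have mC k : <<s @measurable clopen_display clopen_cantor >> (C k).
  by have [n /determined_measurable] := CP k.
exists (lim_sup_set C); split => //.
  apply: bigcap_measurable => [|k _]; first by exists 0%N.
  by apply: bigcup_measurable => j _; exact: mC.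
apply: lim_sup_set_cvg0; first exact: mC.
apply: (@le_lt_trans _ _ (M * 2)%:E); last exact: ltry.
apply: lime_le; first exact: is_cvg_nneseries.
apply: nearW => n.
apply: (@le_trans _ _ (\sum_(0 <= k < n) (M / k.+1%:R ^+ 2)%:E)%E).
  apply: lee_sum => k _; have [m dC PC] := CP k.
  by rewrite [leLHS](product_measure_determined dC) lee_fin.
have M0 : 0 <= M.
  have [m _] := CP 0%N; rewrite expr1n divr1; exact/le_trans/coin_prob_ge0.
by rewrite sumEFin lee_fin big_mkord -mulr_sumr ler_wpM2l // sum_inv_squares.
Qed.

Lemma null_setsS (A B : set cantor_space) :
  A `<=` B -> null_sets R B -> null_sets R A.
Proof.
by move=> AB [C [mC C0 BC]]; exists C; split=> //; exact: subset_trans BC.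
Qed.

Lemma null_setsU (A B : set cantor_space) :
  null_sets R A -> null_sets R B -> null_sets R (A `|` B).
Proof. exact: (@negligibleU _ _ _ (product_measure R)). Qed.

Lemma not_null_setT : ~ null_sets R setT.
Proof.
move=> N; have := product_measure_cylinder R 0 (fun=> false).
rewrite expr0 [X in product_measure R X](_ : _ = setT); last first.
  by apply/seteqP; split.
rewrite (@measure_negligible _ _ _ (product_measure R) _ _ N).
  by move=> /eqP; rewrite eqe eq_sym oner_eq0.
exact: measurableT.
Qed.

Lemma determined_cylinder n (s : cantor_space) :
  determined n [set x | forall i, (i < n)%N -> x i = s i].
Proof. by move=> x y xy xs i ni; rewrite -xy// xs. Qed.

Lemma coin_prob_cylinder n (s : cantor_space) :
  coin_prob R n [set x | forall i, (i < n)%N -> x i = s i] = 2^-1 ^+ n.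
Proof.
apply: EFin_inj; rewrite -(product_measure_cylinder R n s).
by rewrite (product_measure_determined (@determined_cylinder n s)).
Qed.

Lemma inv_pow2_le (k : nat) : 2^-1 ^+ (2 * k) <= 1 / k.+1%:R ^+ 2 :> R.
Proof.
rewrite mulnC exprM -exprVn mul1r ler_sqr ?nnegrE ?exprn_ge0 ?invr_ge0 //.
rewrite exprVn lef_pV2 ?posrE ?exprn_gt0 //.
by rewrite -natrX ler_nat ltn_expl.
Qed.

Lemma null_set1 (x : cantor_space) : null_sets R [set x].
Proof.
pose C k : set clopen_cantor :=
  [set y : cantor_space | forall i, (i < 2 * k)%N -> y i = x i].
apply: (@null_setsS _ (lim_sup_set C)); first by move=> y -> n _; exists n => /=.
apply: (@borel_cantelli 1) => k; exists (2 * k)%N.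
  exact: determined_cylinder.
by rewrite coin_prob_cylinder inv_pow2_le.
Qed.

End null_sets.

(** * Expectation and independence on finitely many bits *)

Section mean.
Local Open Scope ring_scope.
Context (R : realType).
Implicit Types (f g : cantor_space -> R) (D E : set nat).

(** The expectation of [f] at [n] fair coin tosses followed by [point]; the
    recursion is that of [coin_prob], which is the case of indicator functions. *)
Fixpoint mean (n : nat) f : R :=
  if n is m.+1 then
    (mean m (f \o seq_cons false) + mean m (f \o seq_cons true)) / 2
  else f point.

Lemma mean_indicator n (A : set cantor_space) :
  mean n (fun x => (x \in A)%:R) = coin_prob R n A.
Proof. by elim: n A => [//|n IH] A; rewrite /= -!IH. Qed.

Lemma meanD n f g : mean n (fun x => f x + g x) = mean n f + mean n g.
Proof. by elim: n f g => [//|n IH] f g; rewrite /= !IH; lra. Qed.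

Lemma meanZ n c f : mean n (fun x => c * f x) = c * mean n f.
Proof. by elim: n f => [//|n IH] f; rewrite /= !IH; lra. Qed.

Lemma mean_cst n c : mean n (fun=> c) = c.
Proof. by elim: n => [//|n IH]; rewrite /= !IH; lra. Qed.

Lemma ler_mean n f g : (forall x, f x <= g x) -> mean n f <= mean n g.
Proof.
elim: n f g => [|n IH] f g fg /=; first exact: fg.
by have := IH _ _ (fun x => fg (seq_cons false x));
  have := IH _ _ (fun x => fg (seq_cons true x)); rewrite /comp; lra.
Qed.

Lemma mean_sum n m (F : nat -> cantor_space -> R) :
  mean n (fun x => \sum_(k < m) F k x) = \sum_(k < m) mean n (F k).
Proof.
elim: m => [|m IH].
  rewrite big_ord0 -[RHS](mean_cst n); congr mean.
  by apply/funext => x; rewrite big_ord0.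
rewrite big_ord_recr /= -IH -meanD; congr mean; apply/funext => x.
by rewrite big_ord_recr.
Qed.

Lemma coin_probT n : coin_prob R n setT = 1.
Proof.
by elim: n => [|n IH] /=; rewrite ?in_setT // !preimage_setT IH; lra.
Qed.

Lemma coin_prob_le1 n (A : set cantor_space) : coin_prob R n A <= 1.
Proof.
rewrite -mean_indicator -[leRHS](mean_cst n) ler_mean // => x.
by rewrite lern1 leq_b1.
Qed.

Definition drop_bits (s : nat) (x : cantor_space) : cantor_space :=
  fun i => x (s + i)%N.

Lemma mean_drop_bits s n f : mean (s + n) (f \o drop_bits s) = mean n f.
Proof.
elim: s => [//|s IH]; rewrite addSn /=.
have E b : (f \o drop_bits s.+1) \o seq_cons b = f \o drop_bits s by [].
by rewrite !E IH; lra.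
Qed.

Definition depends_on D f :=
  forall x y, (forall i, D i -> x i = y i) -> f x = f y.

Lemma depends_on_cons b D f :
  depends_on D f -> depends_on [set i | D i.+1] (f \o seq_cons b).
Proof. by move=> fD x y xy; apply: fD => -[//|i] /xy. Qed.

Lemma depends_on_cons0 D f :
  depends_on D f -> ~ D 0%N -> f \o seq_cons true = f \o seq_cons false.
Proof. by move=> fD D0; apply/funext => x; apply: fD => -[/D0//|i]. Qed.

(** Functions of disjoint sets of bits are independent: the first bit can matter
    to one of the two factors only, so the other factor comes out of the average
    over that bit. *)
Lemma mean_indep n D E f g : depends_on D f -> depends_on E g ->
  D `&` E = set0 -> mean n (fun x => f x * g x) = mean n f * mean n g.
Proof.
elim: n D E f g => [//|n IH] D E f g fD gE DE /=.
have {}IH b := IH _ _ _ _ (depends_on_cons b fD) (depends_on_cons b gE).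
have DE1 : [set i | D i.+1] `&` [set i | E i.+1] = set0.
  by rewrite -subset0 => i Ai; have : (D `&` E) i.+1 by []; rewrite DE.
rewrite (IH false) ?(IH true) //.
have [D0|D0] := pselect (D 0%N).
  have E0 : ~ E 0%N by move=> E0; have : (D `&` E) 0%N by []; rewrite DE.
  by rewrite (depends_on_cons0 gE E0); lra.
by rewrite (depends_on_cons0 fD D0); lra.
Qed.

End mean.

(** * Sublinear sequences *)

Section sublinear.
Local Open Scope ring_scope.
Context (R : realType).
Implicit Types (a b : nat -> R).

(** This is a n = o(n), in a form that needs no threshold on [n]. *)
Definition sublinear a :=
  forall e : R, 0 < e -> exists C, forall n, `|a n| <= C + e * n%:R.

Lemma sublinearD a b :
  sublinear a -> sublinear b -> sublinear (fun n => a n + b n).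
Proof.
move=> sa sb e e0; have e2 : 0 < e / 2 by lra.
have [A Aa] := sa _ e2; have [B Bb] := sb _ e2; exists (A + B) => n.
by have := ler_normD (a n) (b n); have := Aa n; have := Bb n; lra.
Qed.

Lemma sublinear_le a b :
  (forall n, `|a n| <= b n) -> sublinear b -> sublinear a.
Proof.
move=> ab sb e e0; have [C Cb] := sb e e0; exists C => n.
by have := ab n; have := Cb n; have := ler_norm (b n); lra.
Qed.

Lemma sublinear_cvg0 a :
  sublinear a -> (fun n => a n / n%:R) @ \oo --> (0 : R).
Proof.
move=> sa; apply/cvgrPdist_le => e e0; have e2 : 0 < e / 2 by lra.
have [C Ca] := sa _ e2.
near=> n.
have n0 : (0 : R) < n%:R by near: n; exact: nbhs_infty_gtr.
rewrite sub0r normrN normrM normfV (gtr0_norm n0) ler_pdivrMr //.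
have Cn : C / (e / 2) <= n%:R by near: n; exact: nbhs_infty_ger.
by move: Cn; rewrite ler_pdivrMr //; have := Ca n; lra.
Unshelve. all: by end_near. Qed.

End sublinear.

(** * The strong law of large numbers for functions of disjoint blocks of bits *)

Section strong_law.
Local Open Scope ring_scope.
Context (R : realType) (X : nat -> cantor_space -> R).
Context (D : nat -> set nat) (b : nat -> nat).
Hypothesis X_D : forall i, depends_on (D i) (X i).
Hypothesis D_disj : forall i j, i <> j -> D i `&` D j = set0.
Hypothesis D_b : forall i, D i `<=` [set j | (j < b i)%N].
Hypothesis X_mean : forall i n, (b i <= n)%N -> mean n (X i) = 0.
Hypothesis X_le1 : forall i x, `|X i x| <= 1.
Context (s : nat -> nat).
Hypothesis s_inj : injective s.

Let S n x := \sum_(k < n) X (s k) x.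
Let L n := (\max_(k < n) b (s k))%N.

(** The covariances vanish, so the variance of a sum of n terms is at most n. *)
Lemma mean_sum_sq n : mean (L n) (fun x => S n x ^+ 2) <= n%:R.
Proof.
(* The number of bits is generalized so that it stays fixed in the induction. *)
have : forall m, (L n <= m)%N -> mean m (fun x => S n x ^+ 2) <= n%:R; last exact.
rewrite /L => m; elim: n => [|n IH].
  move=> _; suff -> : (fun x => S 0 x ^+ 2) = fun=> 0 by rewrite mean_cst.
  by apply/funext => x; rewrite /S big_ord0 expr0n.
rewrite big_ord_recr /= geq_max => /andP[/IH {}IH bm].
have -> : (fun x => S n.+1 x ^+ 2) = fun x =>
    (S n x ^+ 2 + 2 * (\sum_(k < n) X (s k) x * X (s n) x)) + X (s n) x ^+ 2.
  by apply/funext => x; rewrite /S big_ord_recr /= -mulr_suml; lra.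
rewrite !meanD meanZ (mean_sum m n (fun k x => X (s k) x * X (s n) x)).
rewrite big1 => [|k _].
  rewrite mulr0 addr0 -natr1 lerD // -[leRHS](mean_cst m) ler_mean // => x.
  by rewrite -real_normK ?num_real// expr_le1.
rewrite (mean_indep m (@X_D (s k)) (@X_D (s n))) ?(X_mean bm) ?mulr0 //.
by apply: D_disj => /s_inj kn; have := ltn_ord k; rewrite kn ltnn.
Qed.

Lemma deviation_determined n t : determined (L n) [set x | t <= `|S n x|].
Proof.
move=> x y xy /=; suff -> : S n x = S n y by [].
apply: eq_bigr => k _; apply: X_D => i /D_b /= ib; apply: xy.
by apply: leq_trans ib _; rewrite /L (bigD1 k) //= leq_maxl.
Qed.

Lemma chebyshev n t : 0 < t ->
  coin_prob R (L n) [set x | t <= `|S n x|] <= n%:R / t ^+ 2.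
Proof.
move=> t0; rewrite -mean_indicator ler_pdivlMr ?exprn_gt0 // mulrC -meanZ.
apply: le_trans (mean_sum_sq n); apply: ler_mean => x.
have [/set_mem /= tS|_] := boolP (x \in _); last by rewrite mulr0 sqr_ge0.
by rewrite mulr1 -[leRHS]real_normK ?num_real // ler_sqr ?nnegrE // ltW.
Qed.

Lemma sum_gap m n x : (m <= n)%N -> `|S n x| <= `|S m x| + (n - m)%:R.
Proof.
move=> mn; rewrite -[in `|S n x|](subnKC mn); elim: (n - m)%N => [|k IH].
  by rewrite addn0 addr0.
rewrite addnS /S big_ord_recr /= -/(S _ _) -natr1.
have := ler_normD (S (m + k) x) (X (s (m + k)%N) x).
by have := X_le1 (s (m + k)%N) x; lra.
Qed.

(** By Chebyshev's inequality the sum of m^4 terms exceeds m^3 with probability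
    at most m^4 / m^6, which is summable, and consecutive fourth powers near m^4
    differ by O(m^3) only; hence almost surely S n = O(n^(3/4)). *)
Lemma strong_lln : null_sets R [set x | ~ sublinear (fun n => S n x)].
Proof.
pose C k : set clopen_cantor := [set x | (k.+1 ^ 3)%:R <= `|S (k.+1 ^ 4) x|].
apply: (@null_setsS _ _ (lim_sup_set C)); last first.
  apply: (@borel_cantelli _ 1) => k; exists (L (k.+1 ^ 4)).
    exact: deviation_determined.
  apply: le_trans (chebyshev _ _) _; first by rewrite ltr0n expn_gt0.
  rewrite -!natrX mul1r ler_pdivrMr ?ltr0n ?expn_gt0 // mulrC.
  rewrite ler_pdivlMr ?ltr0n ?expn_gt0 //.
  by rewrite -natrM ler_nat; lia.
move=> x; apply: contra_notP => /existsNP[K KC] e e0.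
have C_lt k : (K <= k)%N -> `|S (k.+1 ^ 4) x| <= (k.+1 ^ 3)%:R.
  by move=> Kk; rewrite leNgt; apply/negP => /ltW Ck; apply: KC => _; exists k.
(* For m >= N, e m >= 16, where 16 m^3 bounds m^3 plus the gap (m+1)^4 - m^4. *)
pose N := (maxn K (Num.truncn (16 / e))).+1.
have eN m : (N <= m)%N -> 16 <= e * m%:R.
  move=> Nm; rewrite mulrC -ler_pdivrMr // ltW // (lt_le_trans (truncnS_gt _)) //.
  by rewrite ler_nat; apply: leq_trans Nm; rewrite ltnS leq_maxr.
exists (N ^ 4)%:R => n; have [nN|Nn] := ltnP n (N ^ 4).
  have := sum_gap x (leq0n n); rewrite {2}/S big_ord0 normr0 add0r subn0 => Sn.
  have : n%:R <= (N ^ 4)%:R :> R by rewrite ler_nat ltnW.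
  have en0 : 0 <= e * n%:R by rewrite mulr_ge0 // ltW.
  by lra.
have [m mn m_max] : exists2 m, (m ^ 4 <= n)%N & (n < m.+1 ^ 4)%N.
  have ub m : (m ^ 4 <= n)%N -> (m <= n)%N.
    apply: leq_trans; rewrite -[leqLHS]expn1.
    by case: m => // m; rewrite leq_pexp2l.
  have [|m m1 m2] := ex_maxnP _ ub; first by exists 0%N.
  by exists m => //; rewrite ltnNge; apply/negP => /m2; rewrite ltnn.
have Nm : (N <= m)%N.
  rewrite -ltnS ltnNge; apply/negP => mN.
  by move: m_max; rewrite ltnNge (leq_trans _ Nn)// leq_exp2r.
have m1 : m.-1.+1 = m by rewrite prednK //; exact: leq_trans Nm.
have Km : (K <= m.-1)%N.
  by rewrite -ltnS m1; apply: leq_trans Nm; rewrite ltnS leq_maxl.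
have := C_lt _ Km; rewrite m1 => Sm; have Snm := sum_gap x mn.
have gap : ((n - m ^ 4)%:R <= (15 * m ^ 3)%:R :> R).
  by rewrite ler_nat; move: m_max (leq_trans (ltn0Sn _) Nm); clear; nia.
have m3n : 16 * (m ^ 3)%:R <= e * n%:R.
  apply: (@le_trans _ _ (e * m%:R * (m ^ 3)%:R)).
    by rewrite ler_wpM2r ?eN.
  by rewrite -mulrA -natrM -expnS ler_wpM2l ?ler_nat // ltW.
have N0 : 0 <= (N ^ 4)%:R :> R by [].
by move: gap; rewrite natrM; lra.
Qed.

End strong_law.

(** * Counting functions and densities *)

Section counting.

Lemma initial_cardE (A : set nat) n :
  initial_card A n = \sum_(i < n) ((i : nat) \in A).
Proof. by rewrite /initial_card -sum1_card big_mkcond. Qed.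

Lemma initial_card_image (p q : nat -> nat) (A : set nat) n :
  cancel p q -> cancel q p ->
  initial_card (p @` A) n = \sum_(k < n) (q k \in A).
Proof.
move=> pq qp; rewrite initial_cardE; apply: eq_bigr => k _; congr nat_of_bool.
apply/idP/idP => /set_mem; first by move=> [m Am <-]; rewrite pq mem_set.
by move=> Aqk; apply/mem_set; exists (q k).
Qed.

Lemma count_injective (s : nat -> nat) n i :
  injective s -> \sum_(k < n) (s k == i) <= 1.
Proof.
move=> s_inj; elim: n => [|n IH]; first by rewrite big_ord0.
rewrite big_ord_recr /=; case: eqP => [sn|_]; last by rewrite addn0.
rewrite big1 // => k _; case: eqP => // sk.
by have := ltn_ord k; rewrite (s_inj k n) ?ltnn // sk.
Qed.

Lemma initial_card_range (u : nat -> nat) n B :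
  (forall k, u k < n -> k < B) -> initial_card (range u) n <= B.
Proof.
move=> uB; rewrite initial_cardE.
apply: (@leq_trans (\sum_(i < n) \sum_(k < B) (i == u k :> nat))).
  apply: leq_sum => i _; case: (boolP (_ \in _)) => // /set_mem[k _ uk].
  have kB : k < B by apply: uB; rewrite uk.
  by rewrite (bigD1 (Ordinal kB)) //= uk eqxx.
rewrite exchange_big /= -[leqRHS](muln1 B) -[X in (_ <= X * 1)%N]card_ord.
rewrite -sum_nat_const leq_sum // => k _.
exact: (@count_injective id).
Qed.

End counting.

Section density.
Local Open Scope ring_scope.
Context (R : realType).

Lemma sparse_sublinear (u : nat -> nat) K :
  (forall k, (K <= k)%N -> (k ^ 2 <= u k)%N) ->
  sublinear (fun n => (initial_card (range u) n)%:R : R).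
Proof.
move=> Ku e e0; have [M M0 eM] : exists2 M, (0 < M)%N & e^-1 < M%:R.
  by exists (Num.truncn e^-1).+1 => //; exact: truncnS_gt.
(* If k >= K, M and u k < n then k M <= k^2 < n, so k is at most n / M. *)
exists (K + M + 1)%N%:R => n; rewrite ger0_norm //.
apply: (@le_trans _ _ ((K + M + 1)%N%:R + (n %/ M)%N%:R)).
  rewrite -natrD ler_nat; apply: initial_card_range => k un.
  suff : (k < K + M \/ k <= n %/ M)%N by move: (n %/ M)%N => q; lia.
  have [kK|/Ku ku] := ltnP k K; first by left; lia.
  have [kM|Mk] := ltnP k M; first by left; lia.
  by right; rewrite leq_divRL //; nia.
rewrite lerD2l; apply: (@le_trans _ _ (e * (n %/ M * M)%N%:R)); last first.
  by rewrite ler_wpM2l ?ler_nat ?leq_divM // ltW.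
by rewrite natrM mulrCA ler_peMr // mulrC -ler_pdivrMr // div1r ltW.
Qed.

Lemma sublinear_density (A : set nat) (r : R) :
  sublinear (fun n => (initial_card A n)%:R - r * n%:R) -> density A = Dens r.
Proof.
move=> /sublinear_cvg0 Ar.
have : density_seq A @ \oo --> r.
  rewrite -[r]add0r; apply: cvg_trans (cvgD Ar (cvg_cst r)).
  apply: near_eq_cvg; near=> n.
  have n0 : (n%:R : R) != 0.
    by rewrite pnatr_eq0 -lt0n; near: n; exact: nbhs_infty_gt.
  by rewrite /density_seq fctE mulrBl mulfK // subrK.
move=> /cvg_limn_inf_sup[li ls].
by rewrite /density /lower_density /upper_density li ls eqxx.
Unshelve. all: by end_near. Qed.

Lemma density_Dens_cvg (A : set nat) (r : R) :
  density A = Dens r -> density_seq A @ \oo --> r.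
Proof.
rewrite /density; case: eqP => // lu [<-].
have u01 n : 0 <= (density_seq A n : R) <= 1.
  rewrite divr_ge0 //=; case: n => [|n].
    by rewrite /density_seq mulr0n invr0 mulr0 ler01.
  rewrite ler_pdivrMr ?ltr0n // mul1r ler_nat -[leqRHS]card_ord.
  exact: max_card.
have lb : has_lbound (range (density_seq A : R^nat)).
  by exists 0 => _ [n _ <-]; case/andP: (u01 n).
have ub : has_ubound (range (density_seq A : R^nat)).
  by exists 1 => _ [n _ <-]; case/andP: (u01 n).
have infs_cvg : infs (density_seq A) @ \oo --> (lower_density A : R).
  by have /cvgP := cvg_infs_sup ub lb.
have sups_cvg : sups (density_seq A) @ \oo --> (lower_density A : R).
  by rewrite lu; have /cvgP := cvg_sups_inf ub lb.
apply: squeeze_cvgr infs_cvg sups_cvg; apply: nearW => n; apply/andP; split.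
  by apply: ge_inf; [exact: has_lbound_sdrop|exists n => /=].
by apply: ub_le_sup; [exact: has_ubound_sdrop|exists n => /=].
Qed.

End density.

(** * Random sets whose permuted images have a given density *)

Section prefix_code.

(** The length 4k leaves room for k^2 values of the code: an event of probability
    at most k^2 2^-4k <= 1 / (k + 1)^2 is obtained from them. *)
Definition prefix_code (k : nat) (x : cantor_space) : nat :=
  pickle [seq x i | i <- iota 0 (4 * k)].

Lemma prefix_code_inj j k x y : prefix_code j x = prefix_code k y ->
  j = k /\ forall i, (i < 4 * k)%N -> x i = y i.
Proof.
move=> /(pcan_inj pickleK) xy.
have jk : j = k by have := congr1 size xy; rewrite !size_map !size_iota; lia.
split=> // i ik; rewrite jk in xy.
have := congr1 (nth false ^~ i) xy.
by rewrite !(nth_map 0%N) ?size_iota // nth_iota.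
Qed.

Lemma prefix_code_eq k x y :
  (forall i, (i < 4 * k)%N -> x i = y i) -> prefix_code k x = prefix_code k y.
Proof.
by move=> xy; congr pickle; apply/eq_in_map => i; rewrite mem_iota => /xy.
Qed.

End prefix_code.

Section random_sets.
Local Open Scope ring_scope.
Context (R : realType).

Lemma coin_prob_lt n (f : cantor_space -> nat) (d : R) m :
  (forall j, coin_prob R n [set x | f x = j] <= d) ->
  coin_prob R n [set x | (f x < m)%N] <= m%:R * d.
Proof.
move=> fd; elim: m => [|m IH].
  by rewrite mul0r (_ : [set x | _] = set0) ?coin_prob0 // -subset0.
have -> : [set x | (f x < m.+1)%N] = [set x | (f x < m)%N] `|` [set x | f x = m].
  apply/seteqP; split => x /=; rewrite ltnS; last by case=> [/ltnW|->].
  by rewrite leq_eqVlt => /orP[/eqP|]; [right|left].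
rewrite coin_probU; first by rewrite -natr1 mulrDl mul1r lerD.
by rewrite -subset0 => x [/= + fm]; rewrite fm ltnn.
Qed.

(** For fixed j the equation p (prefix_code k x) = j determines the first 4k
    bits of x, so it has probability at most 2^-4k; the event
    p (prefix_code k x) < k^2 is a union of k^2 of these. *)
Lemma sparse_codes (p : nat -> nat) : injective p ->
  null_sets R [set x | ~ sublinear (fun n =>
    (initial_card (range (fun k => p (prefix_code k x))) n)%:R : R)].
Proof.
move=> p_inj.
pose C k : set clopen_cantor := [set x | (p (prefix_code k x) < k ^ 2)%N].
apply: (@null_setsS _ _ (lim_sup_set C)); last first.
  apply: (@borel_cantelli _ 1) => k; exists (4 * k)%N.
    by move=> x y /prefix_code_eq xy; rewrite /C /= xy.
  apply: (@le_trans _ _ ((k ^ 2)%N%:R * 2^-1 ^+ (4 * k))).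
    apply: coin_prob_lt => j.
    have [[y py]|none] := pselect (exists y, p (prefix_code k y) = j); last first.
      rewrite (_ : [set x | _] = set0) ?coin_prob0 ?exprn_ge0 ?invr_ge0 //.
      by rewrite -subset0 => x /= px; apply: none; exists x.
    rewrite -(coin_prob_cylinder R (4 * k) y).
    rewrite (_ : [set x | p _ = j] =
      [set x | forall i, (i < 4 * k)%N -> x i = y i]) //.
    apply/seteqP; split => x /=; first by rewrite -py => /p_inj /prefix_code_inj[].
    by rewrite -py => /prefix_code_eq ->.
  rewrite exprVn ler_pdivrMr ?exprn_gt0 // mulrAC mul1r.
  rewrite ler_pdivlMr ?exprn_gt0 // -!natrX -natrM ler_nat mulnC expnM.
  have := ltn_expl k (isT : 1 < 2)%N; rewrite expnAC => km.
  rewrite -[(_ ^ 4)%N]/((2 ^ k) ^ (2 + 2))%N expnD.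
  by rewrite leq_mul // leq_exp2r // ltnW.
move=> x; apply: contra_notP => /existsNP[K KC].
apply: (sparse_sublinear (K := K)) => k Kk.
by rewrite leqNgt; apply/negP => Ck; apply: KC => _; exists k.
Qed.

(** Read the bits as a binary expansion and compare it with that of r: the first
    bit decides unless it agrees with the first digit of r, and then the
    comparison goes on with the remainder 2 r or 2 r - 1. *)
Lemma clopen_approx (n : nat) (r : R) : 0 <= r <= 1 ->
  exists2 A, determined n A & `|coin_prob R n A - r| <= 2^-1 ^+ n.
Proof.
elim: n r => [|n IH] r r01.
  by exists set0 => //; rewrite coin_prob0 expr0 ler_norml; lra.
have cons_det (B : bool -> set cantor_space) : (forall b, determined n (B b)) ->
    determined n.+1 [set x | B (x 0%N) (fun i => x i.+1)].
  by move=> dB x y xy /=; rewrite xy //; apply: dB => i ni; exact: xy.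
rewrite exprS; have [r2|r2] := lerP r (2^-1).
  have [|A dA PA] := IH (2 * r); first by lra.
  exists [set x | (if x 0%N then set0 else A) (fun i => x i.+1)].
    by apply: (cons_det (fun b => if b then set0 else A)) => -[].
  rewrite /= [X in coin_prob R n X + _](_ : _ = A)
    ?[X in _ + coin_prob R n X](_ : _ = set0) //.
  by rewrite coin_prob0; move: PA; rewrite !ler_norml; lra.
have [|A dA PA] := IH (2 * r - 1); first by lra.
exists [set x | (if x 0%N then A else setT) (fun i => x i.+1)].
  by apply: (cons_det (fun b => if b then A else setT)) => -[].
rewrite /= [X in coin_prob R n X + _](_ : _ = setT)
  ?[X in _ + coin_prob R n X](_ : _ = A) //.
by rewrite coin_probT; move: PA; rewrite !ler_norml; lra.
Qed.

Lemma sum_inv_pow2_injective (s : nat -> nat) n : injective s ->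
  \sum_(k < n) 2^-1 ^+ s k <= 2 :> R.
Proof.
move=> s_inj; pose B := (\max_(k < n) s k).+1.
have sB (k : 'I_n) : (s k < B)%N by rewrite ltnS (bigD1 k) //= leq_maxl.
have -> : \sum_(k < n) 2^-1 ^+ s k =
    \sum_(i < B) \sum_(k < n) (s k == i)%:R * 2^-1 ^+ i :> R.
  rewrite exchange_big /=; apply: eq_bigr => k _.
  rewrite (bigD1 (Ordinal (sB k))) //= eqxx mul1r big1 ?addr0 // => i ik.
  case: eqP => [ski|]; last by rewrite mul0r.
  by move/eqP: ik; case; apply: val_inj.
apply: (@le_trans _ _ (\sum_(i < B) 2^-1 ^+ i)).
  apply: ler_sum => i _; rewrite -mulr_suml -[leRHS]mul1r.
  rewrite ler_wpM2r ?exprn_ge0 ?invr_ge0//.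
  by rewrite -natr_sum lern1 count_injective.
suff : \sum_(i < B) 2^-1 ^+ i = 2 - 2 * 2^-1 ^+ B :> R.
  by move=> ->; rewrite lerBlDr lerDl mulr_ge0 // exprn_ge0 // invr_ge0.
elim: B {sB} => [|B IH]; first by rewrite big_ord0 expr0; lra.
by rewrite big_ord_recr /= IH exprS; lra.
Qed.

(** The bits n^2, ..., n^2 + n - 1 decide whether n is in the set. Clopen events
    have dyadic probabilities, hence the approximations p_n of r; their errors
    are summable along any injection, so they do not affect the density. *)
Lemma bernoulli_set (r : R) : 0 <= r <= 1 ->
  exists F : cantor_space -> set nat,
  forall s : nat -> nat, injective s -> null_sets R [set x |
    ~ sublinear (fun n => \sum_(k < n) (s k \in F x)%:R - r * n%:R : R)].
Proof.
move=> r01.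
have /choice[A AP] n :
    exists A, determined n A /\ `|coin_prob R n A - r| <= 2^-1 ^+ n.
  by have [A] := clopen_approx n r01; exists A.
have dA n := (AP n).1; have PA n := (AP n).2; clear AP.
exists (fun x => [set n | A n (drop_bits (n ^ 2)%N x)]) => s s_inj.
pose X n x : R := (drop_bits (n ^ 2)%N x \in A n)%:R - coin_prob R n (A n).
pose D n := [set i | (n ^ 2 <= i < n.+1 ^ 2)%N].
have X_D n : depends_on (D n) (X n).
  move=> x y xy; rewrite /X; congr (_%:R - _); congr nat_of_bool.
  have sxy i : (i < n)%N -> drop_bits (n ^ 2)%N x i = drop_bits (n ^ 2)%N y i.
    by move=> ni; apply: xy; rewrite /D /=; nia.
  by apply/idP/idP => /set_mem Ax; apply/mem_set; apply: dA Ax => i /sxy.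
have D_disj i j : i <> j -> D i `&` D j = set0.
  by move=> ij; rewrite -subset0 => k []; rewrite /D /= => *; apply: ij; nia.
have X_mean i n : (i.+1 ^ 2 <= n)%N -> mean n (X i) = 0.
  move=> ni; have /subnKC <- : (i ^ 2 <= n)%N by nia.
  rewrite /X (meanD _ _ (fun=> - _)) mean_cst.
  rewrite (mean_drop_bits _ _ (fun x => (x \in A i)%:R)) mean_indicator.
  by rewrite (@coin_prob_determined _ i) ?subrr //; nia.
have X_le1 i x : `|X i x| <= 1.
  have := coin_prob_le1 R i (A i); have := coin_prob_ge0 R i (A i).
  by rewrite /X ler_norml; case: (_ \in A i) => /=; lra.
apply: null_setsS (@strong_lln R X D (fun n => n.+1 ^ 2)%N
  X_D D_disj _ X_mean X_le1 s s_inj); last by move=> i j /andP[].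
move=> x; apply: contra_not => /sublinearD Ss.
have s2 : sublinear (fun=> 2 : R).
  by move=> e e0; exists 2 => n; rewrite ger0_norm // lerDl mulr_ge0 // ltW.
have sp : sublinear (fun n => \sum_(k < n) (coin_prob R (s k) (A (s k)) - r)).
  apply: sublinear_le s2 => n; apply: le_trans (ler_norm_sum _ _ _) _.
  by apply: le_trans (sum_inv_pow2_injective n s_inj); apply: ler_sum.
have := Ss _ sp; congr sublinear; apply/funext => n.
have -> : r * n%:R = \sum_(k < n) r by rewrite sumr_const card_ord mulr_natr.
rewrite -big_split -sumrB /=; apply: eq_bigr => k _; rewrite addrA /X subrK.
by congr (_%:R - _); congr nat_of_bool;
  apply/idP/idP => /set_mem ?; apply/mem_set.
Qed.

Lemma infinite_range (u : nat -> nat) : injective u -> infinite_set (range u).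
Proof.
move=> u_inj; apply/infiniteP.
have : (range u #= [set: nat])%card.
  by apply: inj_card_eq => i j _ _; exact: u_inj.
by rewrite card_eq_le => /andP[].
Qed.

(** Putting the prefix codes of even rank into a Bernoulli set and taking those
    of odd rank out makes it infinite and coinfinite at every x, not just almost
    surely; since the codes are sparse, the density of the image under p stays
    the same. *)
Lemma random_set (r : R) : 0 <= r <= 1 -> exists F : cantor_space -> set nat,
  (forall x, infinite_set (F x) /\ infinite_set (~` F x)) /\
  forall p : nat -> nat, bijective p ->
    null_sets R [set x | density (p @` F x) <> Dens r].
Proof.
move=> /bernoulli_set[G GP].
pose E x := [set prefix_code (2 * k)%N x | k in setT].
pose O x := [set prefix_code (2 * k).+1%N x | k in setT].
exists (fun x => (G x `|` E x) `\` O x); split => [x|p bp].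
  split.
    apply: (@sub_infinite_set _ (E x)).
      move=> _ [k _ <-]; split; first by right; exists k.
      by move=> [j _ /prefix_code_inj[+ _]]; lia.
    by apply: infinite_range => j k /prefix_code_inj[]; lia.
  apply: (@sub_infinite_set _ (O x)); first by move=> n On [_].
  by apply: infinite_range => j k /prefix_code_inj[]; lia.
have [q pq qp] := bp.
apply: null_setsS (null_setsU (sparse_codes (bij_inj bp)) (GP q (can_inj qp))).
move=> x; apply: contra_notP => /not_orP[/contrapT sT /contrapT sG].
apply: sublinear_density.
rewrite (_ : (fun n => _) = fun n =>
  ((initial_card (p @` ((G x `|` E x) `\` O x)) n)%:R -
   \sum_(k < n) (q k \in G x)%:R) +
  (\sum_(k < n) (q k \in G x)%:R - r * n%:R)); last first.
  by apply/funext => n; rewrite addrA subrK.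
apply: sublinearD sG; apply: sublinear_le sT => n.
rewrite (initial_card_image _ _ pq qp) initial_cardE !natr_sum -sumrB.
apply: le_trans (ler_norm_sum _ _ _) _; apply: ler_sum => k _.
have [kT|kT] := boolP ((k : nat) \in range (fun j => p (prefix_code j x))).
  by case: (_ \in _); case: (_ \in _);
    rewrite ?subrr ?subr0 ?sub0r ?normrN ?normr0 ?normr1.
suff -> : (q k \in (G x `|` E x) `\` O x) = (q k \in G x).
  by rewrite subrr normr0.
have kE j : q k <> prefix_code j x.
  move=> qk; move/negP: kT; apply; apply/mem_set; exists j => //.
  by rewrite -qk qp.
apply/idP/idP => /set_mem.
  by move=> [[Gk|[j _ /esym/kE//]] _]; apply/mem_set.
by move=> Gk; apply/mem_set; split; [left|move=> [j _ /esym/kE]].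
Qed.

End random_sets.

(** * All densities are attained *)

Section density_surjective.

Definition dyadic_stripes : set nat := [set n | odd (trunc_log 2 n)].

Lemma initial_card_stripes k j : j <= 2 ^ k ->
  initial_card dyadic_stripes (2 ^ k + j) =
  initial_card dyadic_stripes (2 ^ k) + odd k * j.
Proof.
elim: j => [|j IH] jk; first by rewrite muln0 !addn0.
rewrite addnS initial_cardE big_ord_recr /= -initial_cardE IH 1?ltnW // mulnS.
have -> : (2 ^ k + j \in dyadic_stripes) = odd k.
  have logk : trunc_log 2 (2 ^ k + j) = k.
    by apply: trunc_log_eq => //; rewrite leq_addr expnS; lia.
  by apply/idP/idP => [/set_mem|ok]; [|apply/mem_set];
    rewrite /dyadic_stripes /= logk.
lia.
Qed.

Lemma dyadic_stripes_infinite :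
  infinite_set dyadic_stripes /\ infinite_set (~` dyadic_stripes).
Proof.
have log k : trunc_log 2 (2 ^ k) = k by exact: trunc_expnK.
have expI : injective (expn 2) by move=> j k jk; rewrite -(log j) jk log.
split.
  apply: (@sub_infinite_set _ (range (fun k => 2 ^ (2 * k).+1))).
    by move=> _ [k _ <-]; rewrite /dyadic_stripes /= log; lia.
  by apply: infinite_range => j k /expI; lia.
apply: (@sub_infinite_set _ (range (fun k => 2 ^ (2 * k)))).
  by move=> _ [k _ <-]; rewrite /dyadic_stripes /= log; lia.
by apply: infinite_range => j k /expI; lia.
Qed.

Local Open Scope ring_scope.
Context (R : realType).

(** The densities a_k at 2^k satisfy a_(k+1) = (a_k + c) / 2 with c alternating
    between 0 and 1, so they cannot converge. *)
Lemma density_dyadic_stripes : density dyadic_stripes = Osc :> density_value R.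
Proof.
case E : density => [r|//]; have /cvgrPdist_lt/(_ 8^-1) := density_Dens_cvg E.
case=> [|N _ NP]; first by rewrite invr_gt0.
have aN k : (N <= k)%N -> `|r - density_seq dyadic_stripes (2 ^ k)%N| < 8^-1.
  by move=> Nk; apply: NP => /=; rewrite (leq_trans Nk) // ltnW // ltn_expl.
have step k : density_seq dyadic_stripes (2 ^ k.+1)%N =
    (density_seq dyadic_stripes (2 ^ k)%N + (odd k)%:R) / 2 :> R.
  have k0 : (0 : R) < (2 ^ k)%N%:R by rewrite ltr0n expn_gt0.
  rewrite /density_seq expnS mul2n -addnn initial_card_stripes // natrD natrM.
  rewrite addnn -mul2n natrM invfM [2^-1 * _]mulrC mulrA; congr (_ / 2).
  by rewrite mulrDl mulfK ?gt_eqF.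
have := aN (2 * N)%N; have := aN (2 * N).+1; have := aN (2 * N).+2.
rewrite !step /= mul2n odd_double /= => a2 a1 a0.
have /ltr_normlP[? ?] := a2 ltac:(lia).
have /ltr_normlP[? ?] := a1 ltac:(lia).
have /ltr_normlP[? ?] := a0 ltac:(lia).
by exfalso; clear E; lra.
Qed.

Lemma density_surjective (y : density_value R) : all_values y ->
  exists A, [/\ infinite_set A, infinite_set (~` A) & density A = y].
Proof.
case=> [[r r01 <-]|->]; last first.
  have [? ?] := dyadic_stripes_infinite; exists dyadic_stripes.
  by split => //; exact: density_dyadic_stripes.
have [F [F_inf FP]] := random_set r01.
apply: contrapT => /forallNP no; apply: (@not_null_setT R).
apply: null_setsS (FP id _); last by exists id.
move=> x _ /=; rewrite image_id => dF; apply: (no (F x)).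
by have [] := F_inf x.
Qed.

End density_surjective.

Section permutation.
Local Open Scope card_scope.

Lemma permutation_image (A B : set nat) :
  infinite_set A -> infinite_set (~` A) ->
  infinite_set B -> infinite_set (~` B) ->
  exists2 p : nat -> nat, bijective p & p @` A = B.
Proof.
have cardT (C : set nat) : infinite_set C -> C #= [set: nat].
  by move=> /infiniteP CT; rewrite card_eq_le CT card_leT.
have bijAB (C D : set nat) :
    infinite_set C -> infinite_set D -> exists f, set_bij C D f.
  move=> /cardT C_T /cardT D_T; apply/card_set_bijP.
  by apply: card_eq_trans C_T _; rewrite card_eq_sym.
move=> iA iA' iB iB'.
have [f [fAB f_inj f_surj]] := bijAB _ _ iA iB.
have [g [gAB g_inj g_surj]] := bijAB _ _ iA' iB'.
pose p n := if n \in A then f n else g n.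
have pA n : A n -> p n = f n by move=> An; rewrite /p mem_set.
have pA' n : ~ A n -> p n = g n by move=> An; rewrite /p memNset.
exists p.
  rewrite -setTT_bijective; split => //.
    move=> m n _ _; have [Am|Am] := pselect (A m); have [An|An] := pselect (A n);
      rewrite ?(pA _ Am) ?(pA' _ Am) ?(pA _ An) ?(pA' _ An).
    - by apply: f_inj; exact/mem_set.
    - by move=> fg; have := gAB _ An; rewrite -fg => /(_ (fAB _ Am)).
    - by move=> fg; have := gAB _ Am; rewrite fg => /(_ (fAB _ An)).
    - by apply: g_inj; exact/mem_set.
  move=> n _; have [Bn|Bn] := pselect (B n).
    by have [m Am <-] := f_surj _ Bn; exists m => //; rewrite pA.
  by have [m Am <-] := g_surj _ Bn; exists m => //; rewrite pA'.
apply/seteqP; split => [_ [n An <-]|n Bn]; first by rewrite pA //; exact: fAB.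
by have [m Am <-] := f_surj _ Bn; exists m => //; rewrite pA.
Qed.

End permutation.

(** * The Tukey reduction *)

Theorem theorem18 (R : realType) (X Y : set (density_value R))
  (hX : X `<=` all_values) (hY : Y `<=` all_values)
  (X_neq0 : X !=set0)
  (XY : forall x, X x -> exists2 y, Y y & y <> x)
  (X_unit : X `&` unit_values !=set0) :
  tukey_le (null_triple R) (density_triple X Y).
Proof.
have [d [Xr [r r01 rd]]] := X_unit; rewrite -{}rd in Xr.
have null_total : is_relational_system (null_triple R).
  split=> [x|N]; first by exists (SigSub (mem_set (@null_set1 R x))).
  apply: contrapT => /forallNP N_all; apply: (@not_null_setT R).
  apply: null_setsS (set_valP N) => x _; exact: contrapT (N_all x).
have [F [F_inf FP]] := random_set r01.
have [A0 [A0_inf A0_coinf A0r]] := density_surjective (hX _ Xr).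
pose f x := if pselect (density (F x) = Dens r) then F x else A0.
have fX x : D_ X (f x).
  rewrite /f; case: pselect => [Fr|Fr] /=; last by split=> //; rewrite A0r.
  by have [? ?] := F_inf x; split=> //; rewrite Fr.
pose g (p : nat -> nat) : set cantor_space :=
  [set x | density (F x) <> Dens r] `|` [set x | density (p @` F x) <> Dens r].
have gN (p : Sym_nat) : null_sets R (g (val p)).
  apply: null_setsU; last exact/FP/(set_valP p).
  apply: null_setsS (FP id _); last by exists id.
  by move=> x /=; rewrite image_id.
have fg x (p : Sym_nat) : R_ Y (f x) (val p) -> g (val p) x.
  rewrite /f; case: pselect => [Fr|Fr] /= [_ pF]; last by left.
  by right; rewrite /= -Fr.
pose f' x : D_ X := SigSub (mem_set (fX x)).
pose g' (p : Sym_nat) : null_sets R := SigSub (mem_set (gN p)).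
split => //; last by exists f', g' => x p; exact: fg.
split=> [A|p].
  have [A_inf A_coinf /XY[y Yy yA]] := set_valP A.
  have [B [B_inf B_coinf By]] := density_surjective (hY _ Yy).
  have [p bp pAB] := permutation_image A_inf A_coinf B_inf B_coinf.
  exists (SigSub (mem_set bp)); rewrite /= /R_ /= pAB By; split=> //.
have [x Nx] := null_total.2 (g' p).
by exists (f' x) => /fg.
Qed.
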